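(* Let $\mathbb{K}$ be a field of characteristic zero and let $(L,[\cdot,\cdot],\alpha)$ be a multiplicative Hom-Leibniz algebra over $\mathbb{K}$. Then $\widetilde{CL}^\ast(L,L)$ together with the map $\partial:\widetilde{CL}^n(L,L)\to\widetilde{CL}^{n+1}(L,L)$, $\partial(\phi,\psi)=(\partial_{\gamma\gamma}\phi-\partial_{\alpha\gamma}\psi,\ \partial_{\gamma\alpha}\phi-\partial_{\alpha\alpha}\psi)$, is a cochain complex, that is, $\partial\circ\partial=0$.
   Context: A Hom-Leibniz algebra over $\mathbb{K}$ is a $\mathbb{K}$-vector space $L$ with a $\mathbb{K}$-bilinear map $[\cdot,\cdot]:L\times L\to L$ and a $\mathbb{K}$-linear map $\alpha:L\to L$ such that $[\alpha(x),[y,z]]=[[x,y],\alpha(z)]-[[x,z],\alpha(y)]$ for all $x,y,z\in L$. It is multiplicative if $\alpha([x,y])=[\alpha(x),\alpha(y)]$ for all $x,y\in L$. Cochains: for $n\ge 2$, $\widetilde{CL}^n(L,L)=\widetilde{CL}^n_\gamma(L,L)\oplus\widetilde{CL}^n_\alpha(L,L)$ with $\widetilde{CL}^n_\gamma(L,L)=\mathrm{Hom}_{\mathbb{K}}(L^{\otimes n},L)$ and $\widetilde{CL}^n_\alpha(L,L)=\mathrm{Hom}_{\mathbb{K}}(L^{\otimes (n-1)},L)$; $\widetilde{CL}^1(L,L)=\widetilde{CL}^1_\gamma(L,L)\oplus\widetilde{CL}^1_\alpha(L,L)=\mathrm{Hom}_{\mathbb{K}}(L,L)\oplus\{0\}$;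 $\widetilde{CL}^n(L,L)=\{0\}$ for $n\le 0$. Elements are written $(\phi,\psi)$ with $\phi\in\widetilde{CL}^n_\gamma(L,L)$, $\psi\in\widetilde{CL}^n_\alpha(L,L)$. For $\phi\in\widetilde{CL}^n_\gamma(L,L)$ and $\psi\in\widetilde{CL}^n_\alpha(L,L)$ (a hat means the entry is omitted, $\alpha^0=\mathrm{id}$): $(\partial_{\gamma\gamma}\phi)(x_1,\dots,x_{n+1})=[\alpha^{n-1}(x_1),\phi(x_2,\dots,x_{n+1})]+\sum_{i=2}^{n+1}(-1)^i[\phi(x_1,\dots,\widehat{x_i},\dots,x_{n+1}),\alpha^{n-1}(x_i)]+\sum_{1\le i<j\le n+1}(-1)^{j+1}\phi(\alpha(x_1),\dots,\alpha(x_{i-1}),[x_i,x_j],\alpha(x_{i+1}),\dots,\widehat{\alpha(x_j)},\dots,\alpha(x_{n+1}))$; $(\partial_{\alpha\alpha}\psi)(x_1,\dots,x_{n})=[\alpha^{n-1}(x_1),\psi(x_2,\dots,x_{n})]+\sum_{i=2}^{n}(-1)^i[\psi(x_1,\dots,\widehat{x_i},\dots,x_{n}),\alpha^{n-1}(x_i)]+\sum_{1\le i<j\le n}(-1)^{j+1}\psi(\alpha(x_1),\dots,\alpha(x_{i-1}),[x_i,x_j],\alpha(x_{i+1}),\dots,\widehat{\alpha(x_j)},\dots,\alpha(x_{n}))$; $(\partial_{\gamma\alpha}\phi)(x_1,\dots,x_n)=\alpha(\phi(x_1,\dots,x_n))-\phi(\alpha(x_1),\dots,\alpha(x_n))$;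 $(\partial_{\alpha\gamma}\psi)(x_1,\dots,x_{n+1})=\sum_{i=2}^{n+1}(-1)^i[[\alpha^{n-2}(x_1),\alpha^{n-2}(x_i)],\psi(x_2,\dots,\widehat{x_i},\dots,x_{n+1})]+\sum_{2\le i<j\le n+1}(-1)^{j}[\psi(x_1,\dots,x_{i-1},\widehat{x_i},x_{i+1},\dots,\widehat{x_j},\dots,x_{n+1}),[\alpha^{n-2}(x_i),\alpha^{n-2}(x_j)]]$. For $n=1$, $\partial_{\alpha\alpha}$ and $\partial_{\alpha\gamma}$ are the zero maps, since $\widetilde{CL}^1_\alpha(L,L)=\{0\}$.
   Formalization: In the second sum of ∂_{αγ} the sign (-1)^j is replaced by (-1)^{i+j}; with (-1)^j the claim fails, e.g. for sl_2 with α = id and the degree-2 cochain (0, id), where the first component of ∂∂ is 2[[x_1,x_2],[x_3,x_4]]. *)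

(* Defs.v *)
From HB Require Import structures.
From mathcomp Require Import all_boot all_order all_algebra.
From mathcomp Require Import boolp functions.

Set Implicit Arguments.
Unset Strict Implicit.
Unset Printing Implicit Defensive.

Import GRing.Theory.
Local Open Scope ring_scope.

Section HomLeibniz.
Variables (K : fieldType) (L : lmodType K).

Definition hom_leibniz (br : {bilinear L -> L -> L}) (alpha : {linear L -> L}) :=
  forall x y z : L,
    br (alpha x) (br y z) = br (br x y) (alpha z) - br (br x z) (alpha y).

Definition hom_multiplicative (br : {bilinear L -> L -> L})
    (alpha : {linear L -> L}) :=
  forall x y : L, alpha (br x y) = br (alpha x) (alpha y).

End HomLeibniz.

(* Hom_K(L^{(x) n}, L), presented through the universal property of the tensor
   power as the K-vector space of n-multilinear maps (x_0, ..., x_{n-1}) |-> _ *)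
Section Multilinear.
Variables (K : fieldType) (L : lmodType K) (n : nat).

Definition multilinear : {pred (('I_n -> L) -> L)} := fun f =>
  `[< forall (i : 'I_n) (x : 'I_n -> L) (a : K) (u v : L),
        f [eta x with i |-> a *: u + v] =
        a *: f [eta x with i |-> u] + f [eta x with i |-> v] >].

Lemma multilinearP (f : ('I_n -> L) -> L) :
  reflect (forall (i : 'I_n) (x : 'I_n -> L) (a : K) (u v : L),
             f [eta x with i |-> a *: u + v] =
             a *: f [eta x with i |-> u] + f [eta x with i |-> v])
          (f \in multilinear).
Proof. exact: asboolP. Qed.

Lemma multilinear_submod_closed : submod_closed multilinear.
Proof.
split; first by apply/multilinearP => *; rewrite scaler0 addr0.
move=> b f g /multilinearP fP /multilinearP gP; apply/multilinearP => i x a u v.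
rewrite [LHS]/GRing.add /= [X in X + _]/GRing.scale /= fP gP.
rewrite scalerDr [a *: (_ + _)]scalerDr -!addrA; congr (_ + _).
  by rewrite !scalerA mulrC.
by rewrite addrCA.
Qed.

HB.instance Definition _ := GRing.isSubmodClosed.Build K (('I_n -> L) -> L)
  multilinear multilinear_submod_closed.

Record multilin := Multilin {
  multilin_fun :> ('I_n -> L) -> L;
  multilin_funP : multilin_fun \in multilinear }.

HB.instance Definition _ := [isSub for multilin_fun].
HB.instance Definition _ := [Choice of multilin by <:].
HB.instance Definition _ := [SubChoice_isSubLmodule of multilin by <:].

End Multilinear.

Arguments multilinear {K L n}.
Arguments multilinearP {K L n f}.

(* Arguments are numbered from 1 in the classical formulas and from 0 in 'I_n:
   x_r is x i with r = i.+1, and r is what the exponents of the signs refer to.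
   Omitting x_r from the list x amounts to x \o lift i. *)
Section Differential.
Variables (K : fieldType) (L : lmodType K).
Variables (br : {bilinear L -> L -> L}) (alpha : {linear L -> L}).

Local Notation omit x i := (x \o lift i).

(* The argument list
   (alpha x_1, ..., [x_i, x_j], ..., alpha x_(n+1)) with [x_i, x_j] in place of
   alpha x_i and without alpha x_j; meaningful for i < j. *)
Definition contract n (x : 'I_n.+1 -> L) (i j : 'I_n.+1) : 'I_n -> L :=
  fun k => if lift j k == i then br (x i) (x j) else alpha (x (lift j k)).

(* The common formula for d_{gamma gamma} and d_{alpha alpha}: in degree d both
   use the power p = d - 1, on maps of arity n = d and n = d - 1 respectively. *)
Definition leibniz_d (p n : nat) (f : ('I_n -> L) -> L) : ('I_n.+1 -> L) -> L :=
  fun x =>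
    br (iter p alpha (x ord0)) (f (omit x ord0))
  + \sum_(i < n.+1 | (0 < i)%N)
      (-1) ^+ i.+1 *: br (f (omit x i)) (iter p alpha (x i))
  + \sum_(i < n.+1) \sum_(j < n.+1 | (i < j)%N)
      (-1) ^+ j.+2 *: f (contract x i j).

Definition alpha_d (n : nat) (f : ('I_n -> L) -> L) : ('I_n -> L) -> L :=
  fun x => alpha (f x) - f (alpha \o x).

(* d_{alpha gamma} in degree n = m + 2. In the second sum i < j <= m + 2, so that
   inord i : 'I_m.+2 has value i, and both x_i and x_j are omitted.
   The sign of the second sum is (-1)^(i+j). With (-1)^j, which is found in
   print, the differential does not square to zero: for L = sl_2, alpha = id and
   psi = id, the image of the degree-2 cochain (0, psi) under its square would
   have first component 2 [[x_1, x_2], [x_3, x_4]]. *)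
Definition mixed_d (m : nat) (f : ('I_m.+1 -> L) -> L) : ('I_m.+3 -> L) -> L :=
  fun x =>
    \sum_(i < m.+3 | (0 < i)%N)
      (-1) ^+ i.+1 *: br (br (iter m alpha (x ord0)) (iter m alpha (x i)))
                         (f (omit (omit x i) ord0))
  + \sum_(i < m.+3 | (0 < i)%N) \sum_(j < m.+3 | (i < j)%N)
      (-1) ^+ (i.+1 + j.+1) *: br (f (omit (omit x j) (inord i)))
                                  (br (iter m alpha (x i)) (iter m alpha (x j))).

Lemma iter_alphaP p a u v :
  iter p alpha (a *: u + v) = a *: iter p alpha u + iter p alpha v.
Proof. by elim: p => //= p ->; rewrite linearP. Qed.

Lemma brPl w a u v : br (a *: u + v) w = a *: br u w + br v w.
Proof. exact: linearPl. Qed.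

Lemma brPr w a u v : br w (a *: u + v) = a *: br w u + br w v.
Proof. exact: linearPr. Qed.

Lemma sum_linP (I : finType) (P : pred I) (c : I -> K) (F G H : I -> L) a :
  (forall i, P i -> F i = a *: G i + H i) ->
  \sum_(i | P i) c i *: F i =
  a *: (\sum_(i | P i) c i *: G i) + \sum_(i | P i) c i *: H i.
Proof.
move=> FE; rewrite scaler_sumr -big_split /=; apply: eq_bigr => i Pi.
by rewrite FE // scalerDr !scalerA mulrC.
Qed.

Lemma sum_linP1 (I : finType) (P : pred I) (F G H : I -> L) a :
  (forall i, P i -> F i = a *: G i + H i) ->
  \sum_(i | P i) F i = a *: (\sum_(i | P i) G i) + \sum_(i | P i) H i.
Proof. by move=> FE; rewrite scaler_sumr -big_split; apply: eq_bigr. Qed.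

Lemma add_linP (a : K) (u u' v v' : L) :
  a *: u + u' + (a *: v + v') = a *: (u + v) + (u' + v').
Proof. by rewrite scalerDr addrACA. Qed.

Lemma leibniz_d_linear p n : linear (@leibniz_d p n).
Proof.
move=> a f g; apply/funext => x.
transitivity (a *: leibniz_d p f x + leibniz_d p g x); last by [].
rewrite /leibniz_d.
rewrite -!add_linP; congr (_ + _ + _); first exact: brPr.
  by apply: sum_linP => i _; apply: brPl.
by apply: sum_linP1 => i _; apply: sum_linP.
Qed.

Lemma alpha_d_linear n : linear (@alpha_d n).
Proof.
move=> a f g; apply/funext => x.
transitivity (a *: alpha_d f x + alpha_d g x); last by [].
rewrite /alpha_d.
rewrite [in LHS]/GRing.add /= [in LHS]/GRing.scale /= linearP.
by rewrite -add_linP scalerN opprD.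
Qed.

Lemma mixed_d_linear m : linear (@mixed_d m).
Proof.
move=> a f g; apply/funext => x.
transitivity (a *: mixed_d f x + mixed_d g x); last by [].
rewrite /mixed_d.
rewrite -!add_linP; congr (_ + _).
  by apply: sum_linP => i _; apply: brPr.
by apply: sum_linP1 => i _; apply: sum_linP => j _; apply: brPl.
Qed.

Lemma upd_out n (x : 'I_n -> L) (i k : 'I_n) u :
  k != i -> [eta x with i |-> u] k = x k.
Proof. by rewrite /= => /negbTE->. Qed.

Lemma upd_in n (x : 'I_n -> L) (i : 'I_n) u : [eta x with i |-> u] i = u.
Proof. by rewrite /= eqxx. Qed.

Lemma upd_del_in n (x : 'I_n.+1 -> L) i u : omit [eta x with i |-> u] i = omit x i.
Proof. by apply/funext => k; rewrite /= eq_sym (negbTE (neq_lift _ _)). Qed.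

Lemma upd_del_out n (x : 'I_n.+1 -> L) i k u :
  omit [eta x with lift i k |-> u] i = [eta omit x i with k |-> u].
Proof. by apply/funext => l /=; rewrite (inj_eq lift_inj). Qed.

Lemma upd_iter n (x : 'I_n -> L) (h : L -> L) i u :
  h \o [eta x with i |-> u] = [eta h \o x with i |-> h u].
Proof. by apply/funext => l /=; case: eqP. Qed.

Lemma upd_del2_in n (x : 'I_n.+2 -> L) i k u :
  omit (omit [eta x with lift i k |-> u] i) k = omit (omit x i) k.
Proof. by rewrite upd_del_out upd_del_in. Qed.

Lemma contract_j n (x : 'I_n.+1 -> L) (i j : 'I_n.+1) k u : lift j k = i ->
  contract [eta x with j |-> u] i j = [eta contract x i j with k |-> br (x i) u].
Proof.
move=> ki; apply/funext => l; rewrite /contract upd_in upd_out; last first.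
  by rewrite -ki eq_sym neq_lift.
rewrite -ki /= !(inj_eq lift_inj); case: (l =P k) => //= _.
by rewrite eq_sym (negbTE (neq_lift _ _)).
Qed.

Lemma contract_i n (x : 'I_n.+1 -> L) (i j : 'I_n.+1) k u : lift j k = i ->
  contract [eta x with i |-> u] i j = [eta contract x i j with k |-> br u (x j)].
Proof.
move=> ki; apply/funext => l; rewrite /contract upd_in upd_out; last first.
  by rewrite -ki neq_lift.
rewrite -ki (inj_eq lift_inj) /= (inj_eq lift_inj).
by case: eqP.
Qed.

Lemma contract_o n (x : 'I_n.+1 -> L) (i j : 'I_n.+1) k u :
  lift j k != i ->
  contract [eta x with lift j k |-> u] i j =
  [eta contract x i j with k |-> alpha u].
Proof.
move=> ki; apply/funext => l; rewrite /contract.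
have ik : i != lift j k by rewrite eq_sym.
rewrite (upd_out _ _ ik) (upd_out _ _ (neq_lift _ _)) /=.
rewrite (inj_eq lift_inj); case: (l =P k) => [->|//].
by rewrite (negbTE ki).
Qed.

Lemma contract_linear n (f : ('I_n -> L) -> L) (i j : 'I_n.+1) :
  f \in multilinear -> i != j -> (fun x => f (contract x i j)) \in multilinear.
Proof.
move=> /multilinearP fP ij; apply/multilinearP => l x a u v.
case: (unliftP j i) ij => [k ki|->]; last by rewrite eqxx.
case: (unliftP j l) => [s ->|->] _; last first.
  by rewrite !(contract_j _ _ (esym ki)) brPr fP.
have [<-|ks] := eqVneq i (lift j s).
  by rewrite !(contract_i _ _ (esym ki)) brPl fP.
by rewrite !contract_o 1?eq_sym // linearP fP.
Qed.

(* A bilinear map applied to a multilinear map of all arguments but x_i and to a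
   linear map of x_i. *)
Lemma del_linear n (b : L -> L -> L) (h : L -> L) (f : ('I_n -> L) -> L) i :
  (forall w, linear (b^~ w)) -> (forall w, linear (b w)) -> linear h ->
  f \in multilinear ->
  (fun x : 'I_n.+1 -> L => b (f (omit x i)) (h (x i))) \in multilinear.
Proof.
move=> bl brr hl /multilinearP fP; apply/multilinearP => l x a u v.
case: (unliftP i l) => [s ->|->].
  by rewrite !upd_del_out !(upd_out _ _ (neq_lift _ _)) fP bl.
by rewrite !upd_del_in !upd_in hl brr.
Qed.

Lemma del2_linear n (b : L -> L -> L -> L) (h : L -> L) (f : ('I_n -> L) -> L)
    i k :
  (forall v w, linear (fun u => b u v w)) ->
  (forall u w, linear (fun v => b u v w)) ->
  (forall u v, linear (b u v)) -> linear h -> f \in multilinear ->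
  (fun x : 'I_n.+2 -> L =>
     b (f (omit (omit x i) k)) (h (x (lift i k))) (h (x i))) \in multilinear.
Proof.
move=> b1 b2 b3 hl /multilinearP fP; apply/multilinearP => l x a u v.
case: (unliftP i l) => [s ->|->]; last first.
  rewrite !upd_del_in !upd_in !(upd_out _ _ (_ : lift i k != i)) 1?eq_sym;
    try exact: neq_lift.
  by rewrite hl b3.
rewrite !(upd_out _ _ (neq_lift i s)).
case: (unliftP k s) => [t ->|->].
  rewrite !upd_del_out !upd_out ?(inj_eq lift_inj) ?neq_lift //.
  by rewrite fP b1.
by rewrite !upd_del2_in !upd_in hl b2.
Qed.

Lemma leibniz_d_multilinear p n f : f \in multilinear ->
  @leibniz_d p n f \in multilinear.
Proof.
move=> fP; pose T (i : 'I_n.+1) := fun x : 'I_n.+1 -> L =>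
  br (f (omit x i)) (iter p alpha (x i)).
have -> : leibniz_d p f =
    (fun x => br (iter p alpha (x ord0)) (f (omit x ord0)))
  + \sum_(i < n.+1 | (0 < i)%N) (-1) ^+ i.+1 *: T i
  + \sum_(i < n.+1) \sum_(j < n.+1 | (i < j)%N)
      (-1) ^+ j.+2 *: (fun x => f (contract x i j)).
  apply/funext => x; rewrite !addrfctE !fct_sumE; congr (_ + _ + _).
  by apply: eq_bigr => i _; rewrite fct_sumE.
rewrite !rpredD ?rpred_sum //.
- apply: (@del_linear _ (fun u v => br v u)) => //; try exact: iter_alphaP.
  + by move=> w a u v; rewrite brPr.
  + by move=> w a u v; rewrite brPl.
- move=> i _; apply: rpredZ; apply: del_linear => //; try exact: iter_alphaP.
  + by move=> w a u v; rewrite brPl.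
  + by move=> w a u v; rewrite brPr.
- move=> i _; apply: rpred_sum => j ij; apply/rpredZ/contract_linear => //.
  by rewrite -val_eqE neq_ltn ij.
Qed.

Lemma alpha_d_multilinear n f : f \in multilinear ->
  @alpha_d n f \in multilinear.
Proof.
move=> fP; have -> : alpha_d f = (alpha \o f) - (fun x => f (alpha \o x)) by [].
apply: rpredB; apply/multilinearP => i x a u v; move/multilinearP in fP.
  by rewrite /= fP linearP.
by rewrite !upd_iter linearP fP.
Qed.

Lemma mixed_d_multilinear m f : f \in multilinear ->
  @mixed_d m f \in multilinear.
Proof.
move=> fP.
have -> : mixed_d f =
    \sum_(i < m.+3 | (0 < i)%N) (-1) ^+ i.+1 *: (fun x : 'I_m.+3 -> L =>
      br (br (iter m alpha (x ord0)) (iter m alpha (x i))) (f (omit (omit x i) ord0)))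
  + \sum_(i < m.+3 | (0 < i)%N) \sum_(j < m.+3 | (i < j)%N)
      (-1) ^+ (i.+1 + j.+1) *: (fun x : 'I_m.+3 -> L =>
        br (f (omit (omit x j) (inord i)))
           (br (iter m alpha (x i)) (iter m alpha (x j)))).
  apply/funext => x; rewrite !addrfctE !fct_sumE; congr (_ + _).
  by apply: eq_bigr => i _; rewrite fct_sumE.
rewrite rpredD ?rpred_sum //.
- move=> i i0; apply: rpredZ.
  have -> : ord0 = lift i ord0 by apply/val_inj; rewrite /= /bump leqNgt i0.
  apply: (@del2_linear _ (fun u v w => br (br v w) u)) => //.
  + by move=> v w a u u'; rewrite brPr.
  + by move=> v w a u u'; rewrite !brPl.
  + by move=> v w a u u'; rewrite brPr brPl.
  + exact: iter_alphaP.
- move=> i i0; apply: rpred_sum => j ij; apply: rpredZ.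
  have im : (i < m.+2)%N by apply: leq_trans ij _; rewrite -ltnS.
  have {2}-> : i = lift j (inord i).
    by apply/val_inj; rewrite /= /bump inordK // leqNgt ij.
  apply: (@del2_linear _ (fun u v w => br u (br v w))) => //.
  + by move=> v w a u u'; rewrite brPl.
  + by move=> v w a u u'; rewrite brPl brPr.
  + by move=> v w a u u'; rewrite !brPr.
  + exact: iter_alphaP.
Qed.

Definition d_gg n (phi : multilin L n) : multilin L n.+1 :=
  Multilin (leibniz_d_multilinear n.-1 (multilin_funP phi)).

Definition d_aa m (psi : multilin L m.+1) : multilin L m.+2 :=
  Multilin (leibniz_d_multilinear m.+1 (multilin_funP psi)).

Definition d_ga n (phi : multilin L n) : multilin L n :=
  Multilin (alpha_d_multilinear (multilin_funP phi)).

Definition d_ag m (psi : multilin L m.+1) : multilin L m.+3 :=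
  Multilin (mixed_d_multilinear (multilin_funP psi)).

Lemma d_gg_linear n : linear (@d_gg n).
Proof. by move=> a f g; apply/val_inj; exact: leibniz_d_linear. Qed.

Lemma d_aa_linear m : linear (@d_aa m).
Proof. by move=> a f g; apply/val_inj; exact: leibniz_d_linear. Qed.

Lemma d_ga_linear n : linear (@d_ga n).
Proof. by move=> a f g; apply/val_inj; exact: alpha_d_linear. Qed.

Lemma d_ag_linear m : linear (@d_ag m).
Proof. by move=> a f g; apply/val_inj; exact: mixed_d_linear. Qed.

End Differential.

(* 'rV[K]_0 is the zero space. *)
Definition cochain (K : fieldType) (L : lmodType K) (n : int) : lmodType K :=
  match n with
  | Posz m.+2 => (multilin L m.+2 * multilin L m.+1)%type
  | Posz 1 => (multilin L 1 * 'rV[K]_0)%type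
  | Posz 0 | Negz _ => 'rV[K]_0
  end.

Section Coboundary.
Variables (K : fieldType) (L : lmodType K).
Variables (br : {bilinear L -> L -> L}) (alpha : {linear L -> L}).

(* The target degree is written 1 + n because 1 + Posz m computes to
   Posz m.+1. *)
Definition coboundary (n : int) : cochain L n -> cochain L (1 + n) :=
  match n return cochain L n -> cochain L (1 + n) with
  | Posz m.+2 => fun c =>
      (d_gg br alpha c.1 - d_ag br alpha c.2,
       d_ga alpha c.1 - d_aa br alpha c.2)
  | Posz 1 => fun c => (d_gg br alpha c.1, d_ga alpha c.1)
  | Posz 0 | Negz _ => fun=> 0
  end.

Lemma coboundary_linear n : linear (@coboundary n).
Proof.
case: n => [[|[|m]]|m] a c c' /=; rewrite ?scaler0 ?addr0 //.
  by rewrite d_gg_linear d_ga_linear.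
rewrite d_gg_linear d_ga_linear d_ag_linear d_aa_linear.
by congr (_, _); rewrite opprD addrACA /= scalerBr.
Qed.

HB.instance Definition _ n := GRing.isLinear.Build K (cochain L n)
  (cochain L (1 + n)) _ (@coboundary n) (@coboundary_linear n).

End Coboundary.

(* Main.v *)
Require Import Defs.
From HB Require Import structures.
From mathcomp Require Import all_boot all_order all_algebra.
From mathcomp Require Import boolp functions.

(** A cochain is read as a function of the list of its arguments, last argument
    first, so that every operator is defined by peeling off the last argument.
    Up to sign, the Leibniz differential is [brk (alpha^p) - ctr], where [brk h]
    collects the terms in which an argument is bracketed with the value and
    [ctr] those in which two arguments are bracketed together; the mixed
    differential is [cup [h, h]], in which the bracket of two arguments is
    bracketed with the value. Inductions on the list give [ctr ctr = 0],
    [brk (alpha h) (brk k f) + brk (alpha k) (brk h f) =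
     - (cup [h, k] + cup [k, h]) (alpha f)],
    [brk (h alpha) (ctr f) + ctr (brk h f) = - cup (h [_, _]) (f alpha)],
    and the fact that [brk] and [ctr] pass through [cup [h, h]] up to a twist by
    [alpha]. In characteristic other than two the case [h = k] of the second
    identity computes [brk (alpha h) (brk h f)]. *)

Set Implicit Arguments.
Unset Strict Implicit.
Unset Printing Implicit Defensive.

Import GRing.Theory.
Local Open Scope ring_scope.

(** * Operators on cochains of lists *)

Section ListCochains.
Variables (K : fieldType) (L : lmodType K).
Variables (br : {bilinear L -> L -> L}) (alpha : {linear L -> L}).
Implicit Types (f g : seq L -> L) (h k : L -> L) (c : L -> L -> L) (s : seq L).

(* The first argument of a cochain, the last one of the list, acts on the left;
   since consecutive terms of [brk] alternate in sign, it gets the sign [-1]. *)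
Definition act s (u v : L) : L := if s is [::] then - br u v else br v u.

Fixpoint brk h f s : L :=
  if s is y :: s' then act s' (h y) (f s') - brk h (f \o cons y) s' else 0.

(* The terms of [ctr] in which a given argument [z] becomes [br z y]. *)
Fixpoint der (y : L) f s : L :=
  if s is z :: s' then
    f (br z y :: map alpha s') + der y (f \o cons (alpha z)) s'
  else 0.

Fixpoint ctr f s : L :=
  if s is y :: s' then der y f s' - ctr (f \o cons (alpha y)) s' else 0.

(** The subtracted term collects the pairs whose later member is [y]. *)
Fixpoint cup c f s : L :=
  if s is y :: s' then cup c (f \o cons y) s' - brk (c^~ y) f s' else 0.

Lemma act_linear s u : linear (act s u).
Proof.
by case: s => [|z s] a v w /=; rewrite ?linearPr ?linearPl // opprD scalerN.
Qed.
HB.instance Definition _ s u :=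
  GRing.isLinear.Build K L L _ (act s u) (act_linear s u).

Lemma brk_linear h : linear (brk h).
Proof.
move=> a f g; apply/funext => s.
transitivity (a *: brk h f s + brk h g s); last by [].
elim: s f g => [|y s IH] f g /=; first by rewrite scaler0 addr0.
rewrite -[_ \o _]/(a *: (f \o cons y) + (g \o cons y)) IH.
rewrite -[(_ + g) s]/(a *: f s + g s) linearP.
by rewrite scalerBr opprD addrACA.
Qed.
HB.instance Definition _ h :=
  GRing.isLinear.Build K (seq L -> L) (seq L -> L) _ (brk h) (brk_linear h).

Lemma der_linear y : linear (der y).
Proof.
move=> a f g; apply/funext => s.
transitivity (a *: der y f s + der y g s); last by [].
elim: s f g => [|z s IH] f g /=; first by rewrite scaler0 addr0.
rewrite -[_ \o _]/(a *: (f \o cons (alpha z)) + (g \o cons (alpha z))) IH.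
by rewrite scalerDr addrACA.
Qed.
HB.instance Definition _ y :=
  GRing.isLinear.Build K (seq L -> L) (seq L -> L) _ (der y) (der_linear y).

Lemma ctr_linear : linear ctr.
Proof.
move=> a f g; apply/funext => s.
transitivity (a *: ctr f s + ctr g s); last by [].
elim: s f g => [|y s IH] f g /=; first by rewrite scaler0 addr0.
rewrite -[_ \o _]/(a *: (f \o cons (alpha y)) + (g \o cons (alpha y))) IH.
rewrite linearP -[(_ + der y g) s]/(a *: der y f s + der y g s).
by rewrite scalerBr opprD addrACA.
Qed.
HB.instance Definition _ :=
  GRing.isLinear.Build K (seq L -> L) (seq L -> L) _ ctr ctr_linear.

Lemma cup_linear c : linear (cup c).
Proof.
move=> a f g; apply/funext => s.
transitivity (a *: cup c f s + cup c g s); last by [].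
elim: s f g => [|y s IH] f g /=; first by rewrite scaler0 addr0.
rewrite -[_ \o _]/(a *: (f \o cons y) + (g \o cons y)) IH.
rewrite linearP -[(_ + brk _ g) s]/(a *: brk (c^~ y) f s + brk (c^~ y) g s).
by rewrite scalerBr opprD addrACA.
Qed.
HB.instance Definition _ c :=
  GRing.isLinear.Build K (seq L -> L) (seq L -> L) _ (cup c) (cup_linear c).

Lemma brkD h k f s : brk (fun x => h x + k x) f s = brk h f s + brk k f s.
Proof.
elim: s f => [|y s IH] f /=; first by rewrite addr0.
rewrite IH opprD addrACA; congr (_ + _).
by case: s {IH} => [|z s] /=; rewrite ?linearDl ?linearDr // opprD.
Qed.

Lemma brk_cons h f y :
  brk h f \o cons y = (fun s => act s (h y) (f s)) - brk h (f \o cons y).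
Proof. by []. Qed.
Lemma der_cons y f z : der y f \o cons z =
  (f \o cons (br z y) \o map alpha) + der y (f \o cons (alpha z)).
Proof. by []. Qed.
Lemma ctr_cons f y : ctr f \o cons y = der y f - ctr (f \o cons (alpha y)).
Proof. by []. Qed.
Lemma cup_cons c f y : cup c f \o cons y = cup c (f \o cons y) - brk (c^~ y) f.
Proof. by []. Qed.

Lemma brkB h f g s : brk h (f - g) s = brk h f s - brk h g s.
Proof. by rewrite raddfB. Qed.
Lemma brkfD h f g s : brk h (f + g) s = brk h f s + brk h g s.
Proof. by rewrite raddfD. Qed.
Lemma derB y f g s : der y (f - g) s = der y f s - der y g s.
Proof. by rewrite raddfB. Qed.
Lemma derD y f g s : der y (f + g) s = der y f s + der y g s.
Proof. by rewrite raddfD. Qed.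
Lemma ctrB f g s : ctr (f - g) s = ctr f s - ctr g s.
Proof. by rewrite raddfB. Qed.
Lemma ctrD f g s : ctr (f + g) s = ctr f s + ctr g s.
Proof. by rewrite raddfD. Qed.
Lemma cupB c f g s : cup c (f - g) s = cup c f s - cup c g s.
Proof. by rewrite raddfB. Qed.
Lemma cupfD c f g s : cup c (f + g) s = cup c f s + cup c g s.
Proof. by rewrite raddfD. Qed.

Lemma brk_map h f s :
  brk h f (map alpha s) = brk (h \o alpha) (f \o map alpha) s.
Proof.
elim: s f => //= y s IH f; rewrite IH; congr (_ - _).
by case: s {IH}.
Qed.

Lemma cup_map c f s : cup c f (map alpha s) =
  cup (fun x y => c (alpha x) (alpha y)) (f \o map alpha) s.
Proof. by elim: s f => //= y s IH f; rewrite IH brk_map. Qed.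

Lemma der_br y f v s : der y (fun t => br (f t) v) s = br (der y f s) v.
Proof.
elim: s f => [|z s IH] f /=; first by rewrite linear0l.
by rewrite linearDl -IH.
Qed.

Lemma ctr_br f v s : ctr (fun t => br (f t) v) s = br (ctr f s) v.
Proof.
elim: s f => [|z s IH] f /=; first by rewrite linear0l.
by rewrite linearBl -IH der_br.
Qed.

(** [der] never evaluates its function at the empty list, the only place where [act s v] is not
    right bracketing with [v]. *)
Lemma der_act y v f :
  der y (fun s => act s v (f s)) = der y (fun s => br (f s) v).
Proof. by apply/funext; case. Qed.

Lemma ctr_act v f : ctr (fun s => act s v (f s)) = ctr (fun s => br (f s) v).
Proof. by apply/funext; case => //= y s; rewrite der_act. Qed.

Lemma act_der s v y f : act s v (der y f s) = br (der y f s) v.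
Proof. by case: s => //=; rewrite linear0 linear0l oppr0. Qed.
Lemma act_brk s v h f : act s v (brk h f s) = br (brk h f s) v.
Proof. by case: s => //=; rewrite linear0 linear0l oppr0. Qed.
Lemma act_ctr s v f : act s v (ctr f s) = br (ctr f s) v.
Proof. by case: s => //=; rewrite linear0 linear0l oppr0. Qed.
Lemma act_cup s v c f : act s v (cup c f s) = br (cup c f s) v.
Proof. by case: s => //=; rewrite linear0 linear0l oppr0. Qed.
Lemma act_map s : act (map alpha s) = act s. Proof. by case: s. Qed.

(* Proves an equality between signed sums with the same terms, by cancelling the
   terms of their difference one at a time. *)
Ltac zmod := apply/eqP; rewrite -subr_eq0; apply/eqP;
  rewrite ?(opprD, opprK, oppr0) -[LHS]addr0 -?addrA ?add0r;
  repeat match goal with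
  | |- - ?a + _ = 0 => progress repeat first
      [rewrite [LHS]addKr | rewrite [_ + (a + _)]addrCA]
  | |- ?a + _ = 0 => progress repeat first
      [rewrite [LHS]addNKr | rewrite [_ + (- a + _)]addrCA]
  end; try by [].

(** * Consequences of the Hom-Leibniz identity *)

Hypothesis leib : hom_leibniz br alpha.
Hypothesis mult : hom_multiplicative br alpha.

Lemma leib_skew x y z : br (alpha x) (br y z) = - br (alpha x) (br z y).
Proof. by rewrite !leib opprB. Qed.

(** Hom-Leibniz in both cases: the element under [alpha] on the left is [w] for a nonempty list and
    [u] for the empty one. *)
Lemma act_leib s u v w :
  br (act s u w) (alpha v) - act s (alpha u) (br w v) = act s (br u v) (alpha w).
Proof.
by case: s => [|z s] /=; rewrite leib ?linearNl; zmod.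
Qed.

(** The inner functions differ only at the empty list, reached from one-element lists; there
    [leib_skew] swaps the two factors. *)
Lemma brk_act h v f :
  brk (fun x => alpha (h x)) (fun s => act s v (f s)) =
  brk (fun x => alpha (h x)) (fun s => br (f s) v).
Proof.
apply/funext => -[|y [|z s]] //=.
by rewrite linearN [in RHS]leib_skew.
Qed.

(** Summed form of [act_leib]: moving the right bracket with [v] inside costs the terms in which
    [h x] itself is bracketed with [v]. *)
Lemma brk_adj h v f s :
  br (brk h f s) (alpha v) - brk (fun x => alpha (h x)) (fun s => br (f s) v) s =
  brk (fun x => br (h x) v) (alpha \o f) s.
Proof.
elim: s f => [|z s IH] f /=; first by rewrite linear0l subr0.
rewrite -[(alpha \o f) \o _]/(alpha \o (f \o cons z)) -IH -act_leib linearBl.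
rewrite -[(fun t => br (f t) v) \o _]/(fun t => br ((f \o cons z) t) v).
zmod.
Qed.

Lemma cup_adj c v f s :
  br (cup c f s) (alpha v) -
    cup (fun x y => alpha (c x y)) (fun s => br (f s) v) s =
  cup (fun x y => br (c x y) v) (alpha \o f) s.
Proof.
elim: s f => [|z s IH] f /=; first by rewrite linear0l subr0.
rewrite -[(alpha \o f) \o _]/(alpha \o (f \o cons z)) -IH -brk_adj linearBl.
rewrite -[(fun t => br (f t) v) \o _]/(fun t => br ((f \o cons z) t) v).
zmod.
Qed.

Lemma cupD c c' f s :
  cup (fun x y => c x y + c' x y) f s = cup c f s + cup c' f s.
Proof. by elim: s f => [|y s IH] f /=; rewrite ?addr0 // IH brkD; zmod. Qed.

(** Outer and inner brackets by the same map at [y] pair up under [brk_adj]. Two maps are kept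
    because [brk_cup] combines [alpha \o h] with [[h _, h y]]. *)
Lemma brk_brk_polar h k f s :
  brk (fun x => alpha (h x)) (brk k f) s + brk (fun x => alpha (k x)) (brk h f) s =
  - (cup (fun x y => br (h x) (k y)) (alpha \o f) s +
     cup (fun x y => br (k x) (h y)) (alpha \o f) s).
Proof.
elim: s f => [|y s IH] f /=; first by rewrite !addr0 oppr0.
rewrite !brk_cons !brkB !brk_act !act_brk -!brk_adj.
rewrite -[(alpha \o f) \o _]/(alpha \o (f \o cons y)).
have := IH (f \o cons y); move/(canRL (addrK _)) => ->; zmod.
Qed.

(** The defect comes from the terms of [der y (brk h f)] in which the argument leaving [f] is the
    one that has absorbed [y]. *)
Lemma brk_der h y f s :
  brk (h \o alpha) (der y f) s - der y (brk h f) s =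
  - brk (fun x => h (br x y)) (f \o map alpha) s.
Proof.
elim: s f => [|z s IH] f /=; first by rewrite subr0 oppr0.
rewrite der_cons !brk_cons brkfD derB act_der der_act der_br.
rewrite brk_map act_map.
rewrite -[(f \o map alpha) \o _]/((f \o cons (alpha z)) \o map alpha).
have := IH (f \o cons (alpha z)); move/(canRL (subrK _)) => ->; zmod.
Qed.

Lemma brk_ctr h f s :
  brk (h \o alpha) (ctr f) s + ctr (brk h f) s =
  - cup (fun x y => h (br x y)) (f \o map alpha) s.
Proof.
elim: s f => [|y s IH] f /=; first by rewrite addr0 oppr0.
rewrite ctr_cons brk_cons brkB ctrB ctr_act ctr_br act_ctr.
rewrite -[(f \o map alpha) \o _]/((f \o cons (alpha y)) \o map alpha).
have := IH (f \o cons (alpha y)); move/(canRL (addrK _)) => /= ->.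
by rewrite -[brk (fun _ => _) _ _]opprK -brk_der; zmod.
Qed.

(** * Contractions among the arguments *)

Lemma der_map y f s : der (alpha y) f (map alpha s) = der y (f \o map alpha) s.
Proof. by elim: s f => //= z s IH f; rewrite IH mult. Qed.

Lemma ctr_map f s : ctr f (map alpha s) = ctr (f \o map alpha) s.
Proof. by elim: s f => //= y s IH f; rewrite IH der_map. Qed.

Definition multiadditive f :=
  forall s1 s2 u v, f (s1 ++ (u + v) :: s2) = f (s1 ++ u :: s2) + f (s1 ++ v :: s2).

Lemma multiadditive_cons f y : multiadditive f -> multiadditive (f \o cons y).
Proof. by move=> fP s1; apply: (fP (y :: s1)). Qed.

(** Two contractions in one slot obey Hom-Leibniz, which additivity carries out of [f]; those in
    different slots agree by multiplicativity. *)
Lemma der_der y z f s : multiadditive f ->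
  der z (der (alpha y) f) s =
  der (br z y) f (map alpha s) + der y (der (alpha z) f) s.
Proof.
elim: s f => [|x s IH] f fP /=; first by rewrite addr0.
rewrite !der_cons !derD IH; last exact: multiadditive_cons.
rewrite !der_map !mult leib -[_ :: _]cat0s.
have -> u v t : f ([::] ++ (u - v) :: t) = f (u :: t) - f (v :: t).
  by have := fP [::] t (u - v) v; rewrite subrK /= => ->; rewrite addrK.
zmod.
Qed.

(** When [z] is peeled off, the term [der (br z y)] of [der_der] is the one that [ctr f] produces
    once [z] has absorbed [y]. *)
Lemma ctr_der y f s : multiadditive f ->
  ctr (der (alpha y) f) s = der y (ctr f) s.
Proof.
elim: s f => [|z s IH] f fP //=.
rewrite der_cons ctr_cons ctrD derB IH; last exact: multiadditive_cons.
rewrite der_der // ctr_map mult; zmod.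
Qed.

Lemma ctr_ctr f s : multiadditive f -> ctr (ctr f) s = 0.
Proof.
elim: s f => [|y s IH] f fP //=.
rewrite ctr_cons ctrB ctr_der // IH ?subr0 ?subrr //.
exact: multiadditive_cons.
Qed.

Lemma der_cup y c f s :
  der y (cup c f) s - cup (fun x z => c (alpha x) (alpha z)) (der y f) s =
  cup (fun x z => c (br x y) (alpha z) + c (alpha x) (br z y)) (f \o map alpha) s.
Proof.
elim: s f => [|z s IH] f /=; first by rewrite subr0.
rewrite !cup_cons der_cons derB cupfD brkD cup_map brk_map.
rewrite -[(f \o map alpha) \o _]/((f \o cons (alpha z)) \o map alpha) -IH.
rewrite -[brk (fun _ => c (br _ _) _) _ _]opprK.
by rewrite -(brk_der (fun x => c x (alpha z))); zmod.
Qed.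

(** The hypothesis, a Hom-Leibniz identity for [c], equates the defect of [brk_ctr] for
    [c^~ (alpha y)] with that of [der_cup]. *)
Lemma ctr_cup c f s :
  (forall x y z, c (br x y) (alpha z) =
                 c (br x z) (alpha y) + c (alpha x) (br y z)) ->
  ctr (cup c f) s = cup (fun x y => c (alpha x) (alpha y)) (ctr f) s.
Proof.
move=> cP; elim: s f => [|y s IH] f //=.
rewrite !cup_cons ctr_cons ctrB cupB IH.
have := brk_ctr (fun x => c x (alpha y)) f s.
have -> : (fun x z => c (br x z) (alpha y)) =
          (fun x z => c (br x y) (alpha z) + c (alpha x) (br z y)).
  by apply/funext => x; apply/funext => z; exact: cP.
rewrite -der_cup => /(canRL (addKr _)) ->; zmod.
Qed.

Lemma brk_cup h f s :
  brk (fun x => alpha (alpha (h x))) (cup (fun x y => br (h x) (h y)) f) s =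
  cup (fun x y => br (alpha (h x)) (alpha (h y))) (brk (fun x => alpha (h x)) f) s.
Proof.
elim: s f => [|y s IH] f //=.
have cE : (fun x z => br (alpha (h x)) (alpha (h z))) =
          (fun x z => alpha (br (h x) (h z))).
  by apply/funext => x; apply/funext => z; rewrite mult.
(* By [cE] the coefficients lie in the image of [alpha], as [brk_act] requires. *)
have cup_act v g t : cup (fun x z => br (alpha (h x)) (alpha (h z)))
    (fun s => act s v (g s)) t =
    cup (fun x z => br (alpha (h x)) (alpha (h z))) (fun s => br (g s) v) t.
  rewrite cE; case: t => //= z t.
  by rewrite brk_act.
rewrite !cup_cons !brk_cons brkB cupB -IH cup_act act_cup.
have := cup_adj (fun x z => br (h x) (h z)) (alpha (h y)) f s.
rewrite -cE => /(canRL (subrK _)) ->.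
(* Hom-Leibniz splits the defect of [cup_adj] into the two [cup] terms of [brk_brk_polar] for
   [alpha \o h] and [[h _, h y]]. *)
have -> : (fun x z => br (br (h x) (h z)) (alpha (h y))) =
   (fun x z => br (alpha (h x)) (br (h z) (h y)) + br (br (h x) (h y)) (alpha (h z))).
  by apply/funext => x; apply/funext => z; rewrite leib subrK.
rewrite cupD.
have := brk_brk_polar (fun x => alpha (h x)) (fun x => br (h x) (h y)) f s.
move/(canLR (@opprK _)) => <-.
have -> : (fun x => br (alpha (h x)) (alpha (h y))) =
          (fun x => alpha (br (h x) (h y))).
  by apply/funext => x; rewrite mult.
zmod.
Qed.

Lemma brk_brk h f s : 2 \notin [pchar K] ->
  brk (fun x => alpha (h x)) (brk h f) s =
  - cup (fun x y => br (h x) (h y)) (alpha \o f) s.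
Proof.
move=> K2; have := brk_brk_polar h h f s; rewrite opprD -!mulr2n -!scaler_nat.
by apply: scalerI; move: K2; rewrite inE.
Qed.

End ListCochains.

(** * Differentials of list cochains *)

Section ListDifferentials.
Variables (K : fieldType) (L : lmodType K).
Variables (br : {bilinear L -> L -> L}) (alpha : {linear L -> L}).
Implicit Types (f : seq L -> L) (s : seq L).

(** The global sign depends on the arity, which a function of lists does not carry;
    [represents_leibniz_d] restores it. *)
Definition list_d p f := brk br (iter p alpha) f - ctr br alpha f.

Definition list_mixed_d p f :=
  cup br (fun x y => br (iter p alpha x) (iter p alpha y)) f.

Definition list_alpha_d f := (alpha \o f) - (f \o map alpha).

Lemma list_dZ p a f : list_d p (a *: f) = a *: list_d p f.
Proof. by rewrite /list_d scalerBr -!linearZ. Qed.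

Lemma list_mixed_dZ p a f : list_mixed_d p (a *: f) = a *: list_mixed_d p f.
Proof. exact: linearZ. Qed.

Lemma list_alpha_dZ a f : list_alpha_d (a *: f) = a *: list_alpha_d f.
Proof.
apply/funext => s.
by rewrite -[LHS]/(alpha (a *: f s) - a *: f (map alpha s)) linearZ -scalerBr.
Qed.

Hypothesis leib : hom_leibniz br alpha.
Hypothesis mult : hom_multiplicative br alpha.

Lemma iter_mult p x y :
  iter p alpha (br x y) = br (iter p alpha x) (iter p alpha y).
Proof. by elim: p => //= p ->; rewrite mult. Qed.

Lemma alpha_brk h f s :
  alpha (brk br h f s) = brk br (fun x => alpha (h x)) (alpha \o f) s.
Proof.
elim: s f => [|y s IH] f /=; first by rewrite linear0.
rewrite linearB IH; congr (_ - _).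
by case: s {IH} => [|z s] /=; rewrite ?linearN mult.
Qed.

Lemma alpha_cup c f s :
  alpha (cup br c f s) = cup br (fun x y => alpha (c x y)) (alpha \o f) s.
Proof.
elim: s f => [|y s IH] f /=; first by rewrite linear0.
by rewrite linearB IH alpha_brk.
Qed.

Lemma alpha_der y f s :
  alpha (der br alpha y f s) = der br alpha y (alpha \o f) s.
Proof. by elim: s f => [|z s IH] f /=; rewrite ?linear0 // linearD IH. Qed.

Lemma alpha_ctr f s : alpha (ctr br alpha f s) = ctr br alpha (alpha \o f) s.
Proof.
elim: s f => [|z s IH] f /=; first by rewrite linear0.
by rewrite linearB IH alpha_der.
Qed.

Lemma iterSfun p : iter p alpha \o alpha = iter p.+1 alpha.
Proof. by apply/funext => x; rewrite /= -iterSr. Qed.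

(** Applying [alpha] to the value or to all arguments raises the power in [brk] by one. *)
Lemma list_alpha_list_d p f :
  list_alpha_d (list_d p f) = list_d p.+1 (list_alpha_d f).
Proof.
apply/funext => s.
transitivity (alpha (brk br (iter p alpha) f s - ctr br alpha f s)
  - (brk br (iter p alpha) f (map alpha s) - ctr br alpha f (map alpha s))).
  by [].
rewrite linearB alpha_brk alpha_ctr brk_map ctr_map // iterSfun.
rewrite [RHS](_ : _ = brk br (iter p.+1 alpha) (list_alpha_d f) s
                     - ctr br alpha (list_alpha_d f) s) // brkB ctrB.
by rewrite !opprD !opprK addrACA.
Qed.

Lemma list_alpha_mixed_d p f :
  list_alpha_d (list_mixed_d p f) = list_mixed_d p.+1 (list_alpha_d f).
Proof.
apply/funext => s; rewrite /list_alpha_d /list_mixed_d cupB -[LHS]/(_ - _).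
rewrite /= alpha_cup cup_map; congr (cup _ _ _ _ - cup _ _ _ _).
  by apply/funext => x; apply/funext => y; rewrite mult.
by apply/funext => x; apply/funext => y; rewrite -!iterSr.
Qed.

(** The square of [brk] gives [cup] of [alpha \o f], the cross terms give [cup] of [f \o map alpha],
    and the square of [ctr] vanishes. *)
Lemma list_d_list_d p f : 2 \notin [pchar K] -> multiadditive f ->
  list_d p.+1 (list_d p f) = - list_mixed_d p (list_alpha_d f).
Proof.
move=> K2 fP; apply/funext => s; rewrite /list_d.
transitivity (brk br (iter p.+1 alpha) (brk br (iter p alpha) f) s
  - brk br (iter p.+1 alpha) (ctr br alpha f) s
  - (ctr br alpha (brk br (iter p alpha) f) s - ctr br alpha (ctr br alpha f) s)).
  by rewrite -brkB -ctrB.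
rewrite ctr_ctr // subr0 -addrA -opprD.
rewrite -{2}iterSfun brk_ctr [X in X - _](brk_brk leib) //.
rewrite opprK -[RHS]/(- cup br _ ((alpha \o f) - (f \o map alpha)) s) cupB.
rewrite opprB addrC.
congr (cup _ _ _ _ - _).
by apply/funext => x; apply/funext => y; rewrite iter_mult.
Qed.

Lemma list_d_mixed_d p f : 
  list_d p.+2 (list_mixed_d p f) = list_mixed_d p.+1 (list_d p.+1 f).
Proof.
apply/funext => s; rewrite -[RHS]/(cup br _ (_ - _) s) cupB -[LHS]/(_ - _).
congr (_ - _).
  exact: brk_cup.
rewrite ctr_cup.
  by congr (cup _ _ _ _); apply/funext => x; apply/funext => y; rewrite -!iterSr.
by move=> x y z; rewrite !iter_mult -!iterSr /= leib [RHS]addrC subrK.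
Qed.

End ListDifferentials.

(** * Splitting off the largest index *)

Section SplitLast.
Variable V : nmodType.

Lemma widen_lift_max n (i : 'I_n) : widen_ord (leqnSn n) i = lift ord_max i.
Proof. exact/val_inj/esym/lift_max. Qed.

(** The predicate lives on [nat], so it survives the passage from ['I_n.+1] to ['I_n]. *)
Lemma big_ord_max n (P : pred nat) (G : 'I_n.+1 -> V) :
  \sum_(i < n.+1 | P i) G i =
  \sum_(i < n | P i) G (lift ord_max i) + (if P n then G ord_max else 0).
Proof.
rewrite big_mkcond big_ord_recr /= [in RHS]big_mkcond; congr (_ + _).
by apply: eq_bigr => i _; rewrite widen_lift_max.
Qed.

Lemma big_pair_max n (P : pred nat) (G : 'I_n.+1 -> 'I_n.+1 -> V) :
  \sum_(i < n.+1 | P i) \sum_(j < n.+1 | (i < j)%N) G i j =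
  \sum_(i < n | P i) \sum_(j < n | (i < j)%N) G (lift ord_max i) (lift ord_max j)
  + \sum_(i < n | P i) G (lift ord_max i) ord_max.
Proof.
(* No [j] exceeds the outer index [ord_max]. *)
rewrite (big_ord_max P) [X in _ + X](_ : _ = 0) ?addr0; last first.
  case: (P n) => //; rewrite big1 // => j.
  by rewrite ltnNge -ltnS ltn_ord.
rewrite -big_split; apply: eq_bigr => i _ /=.
rewrite (big_ord_max (fun j => lift ord_max i < j)%N) lift_max ltn_ord.
by congr (_ + _); apply: eq_bigl => j; rewrite lift_max.
Qed.

End SplitLast.

Lemma bump_small h k : (k < h)%N -> bump h k = k.
Proof. by move=> kh; rewrite /bump leqNgt kh. Qed.

Lemma lift_lift_max n (i : 'I_n.+1) (k : 'I_n) :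
  lift (lift ord_max i) (lift ord_max k) = lift ord_max (lift i k).
Proof.
apply/val_inj; rewrite /= (@bump_small n) // !(@bump_small n.+1) //.
by rewrite /bump; case: (i <= k)%N; [|apply: leqW]; exact: ltn_ord.
Qed.

Lemma lift_lift_max_max n (i : 'I_n.+1) :
  lift (lift ord_max i) ord_max = ord_max.
Proof. by apply/val_inj; rewrite /= (@bump_small n.+1) // /bump leq_ord. Qed.

(** The bound excludes [i = n.+1], where the inner [inord] would default to [ord0]. *)
Lemma inord_lift_max n (i : 'I_n.+2) : (i < n.+1)%N ->
  inord (lift ord_max i) = lift ord_max (inord i : 'I_n.+1) :> 'I_n.+2.
Proof.
by move=> i_lt; apply/ord_inj; rewrite !lift_max !inordK // (ltn_trans i_lt).
Qed.

Lemma lift_max0 n : lift ord_max ord0 = ord0 :> 'I_n.+2.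
Proof. exact/val_inj. Qed.

(** * Finite-sum formulas read on reversed argument lists *)

Section ReversedArguments.
Variables (K : fieldType) (L : lmodType K).
Variables (br : {bilinear L -> L -> L}) (alpha : {linear L -> L}).

Local Notation omit x i := (x \o lift i).

(* The last argument comes first. *)
Fixpoint args n : ('I_n -> L) -> seq L :=
  if n is m.+1 then fun x => x ord_max :: args (omit x ord_max) else fun=> [::].

Lemma size_args n (x : 'I_n -> L) : size (args x) = n.
Proof. by elim: n x => //= n IH x; rewrite IH. Qed.

Lemma nth_args n (x : 'I_n -> L) (i : 'I_n) : nth 0 (args x) (n - i.+1) = x i.
Proof.
elim: n x i => [|n IH] x i; first by case: i.
case: (unliftP ord_max i) => [j ->|->] /=; last by rewrite subnn.
by rewrite bump_small // subSS -(subnSK (ltn_ord j)) /= IH.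
Qed.

Lemma args_map (h : L -> L) n (x : 'I_n -> L) : args (h \o x) = map h (args x).
Proof. by elim: n x => //= n IH x; rewrite -IH. Qed.

Lemma args_omit n (x : 'I_n.+2 -> L) (i : 'I_n.+1) :
  args (omit x (lift ord_max i)) = x ord_max :: args (omit (omit x ord_max) i).
Proof.
rewrite /= lift_lift_max_max; congr (_ :: args _).
by apply/funext => k /=; rewrite lift_lift_max.
Qed.

Lemma args_omit2 n (x : 'I_n.+3 -> L) (i : 'I_n.+2) (k : 'I_n.+1) :
  args (omit (omit x (lift ord_max i)) (lift ord_max k)) =
  x ord_max :: args (omit (omit (omit x ord_max) i) k).
Proof.
rewrite args_omit /= lift_lift_max_max; congr (_ :: args _).
by apply/funext => l /=; rewrite lift_lift_max.
Qed.

(** Each peeled argument flips the sign of the remaining terms, hence the factor [(-1)] to the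
    arity. *)
Lemma brk_args h f n (x : 'I_n.+1 -> L) :
  (-1) ^+ n.+1 *: brk br h f (args x) =
    br (h (x ord0)) (f (args (omit x ord0)))
  + \sum_(i < n.+1 | (0 < i)%N)
      (-1) ^+ i.+1 *: br (f (args (omit x i))) (h (x i)).
Proof.
elim: n f x => [|n IH] f x.
  rewrite big_mkcond big_ord1 addr0 /= subr0 expr1 scaleN1r opprK.
  by congr (br (h (x _)) _); apply/val_inj.
have -> : args x = x ord_max :: args (omit x ord_max) by [].
rewrite (big_ord_max (ltn 0)).
under eq_bigr => i _ do rewrite args_omit lift_max.
rewrite -lift_max0 args_omit addrA -(IH (f \o cons (x ord_max)) (omit x ord_max)).
rewrite [brk _ _ _ (_ :: _)]/= scalerBr addrC.
by rewrite [(-1) ^+ n.+2]exprS mulN1r !scaleNr opprK.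
Qed.

Lemma der_args y f n (x : 'I_n -> L) :
  der br alpha y f (args x) =
  \sum_(i < n) f (args (fun k => if k == i then br (x i) y else alpha (x k))).
Proof.
elim: n f x => [|n IH] f x; first by rewrite big_ord0.
rewrite (big_ord_max xpredT) addrC /= IH; congr (_ + _).
  congr (f (_ :: _)); first by rewrite eqxx.
  rewrite -args_map; congr args; apply/funext => k /=.
  by rewrite eq_sym (negbTE (neq_lift _ _)).
apply: eq_bigr => i _; congr (f (_ :: _)).
  by rewrite (negbTE (neq_lift _ _)).
by congr args; apply/funext => k /=; rewrite (inj_eq lift_inj).
Qed.

Local Notation contract := (contract br alpha).

Lemma args_contract n (x : 'I_n.+2 -> L) (i j : 'I_n.+1) : (i < j)%N ->
  args (contract x (lift ord_max i) (lift ord_max j)) =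
  alpha (x ord_max) :: args (contract (omit x ord_max) i j).
Proof.
move=> ij; rewrite /= /contract.
rewrite lift_lift_max_max (negbTE (neq_lift _ _)); congr (_ :: args _).
apply/funext => k /=; rewrite lift_lift_max.
by rewrite (inj_eq lift_inj).
Qed.

(** The terms with [j = ord_max] form the [der] part of [ctr]. *)
Lemma ctr_args f n (x : 'I_n.+1 -> L) :
  - ((-1) ^+ n.+1 *: ctr br alpha f (args x)) =
  \sum_(i < n.+1) \sum_(j < n.+1 | (i < j)%N)
      (-1) ^+ j.+2 *: f (args (contract x i j)).
Proof.
elim: n f x => [|n IH] f x.
  rewrite big_ord1 big_mkcond big_ord1 /=.
  by rewrite subr0 scaler0 oppr0.
have -> : args x = x ord_max :: args (omit x ord_max) by [].
rewrite (big_pair_max xpredT).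
under [X in X + _]eq_bigr => i _.
  under eq_bigr => j ij do rewrite args_contract // lift_max.
  over.
rewrite -(IH (f \o cons (alpha (x ord_max)))) -scaler_sumr.
rewrite -[ctr _ _ _ (_ :: _)]/(der br alpha (x ord_max) f (args (omit x ord_max))
  - ctr br alpha (f \o cons (alpha (x ord_max))) (args (omit x ord_max))).
rewrite der_args scalerBr opprB [(-1) ^+ n.+2]exprS mulN1r !scaleNr opprK.
rewrite -[(-1) ^+ ord_max.+2]/((-1) ^+ n.+3).
rewrite [(-1) ^+ n.+3]exprS [(-1) ^+ n.+2]exprS.
rewrite !mulN1r opprK; congr (- _ + _ *: _).
apply: eq_bigr => i _; congr (f (args _)); apply/funext => k.
by rewrite /contract (inj_eq lift_inj).
Qed.

Lemma cup_args h f n (x : 'I_n.+2 -> L) :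
  cup br (fun u v => br (h u) (h v)) f (args x) =
    \sum_(i < n.+2 | (0 < i)%N)
      (-1) ^+ i.+1 *: br (br (h (x ord0)) (h (x i)))
                         (f (args (omit (omit x i) ord0)))
  + \sum_(i < n.+2 | (0 < i)%N) \sum_(j < n.+2 | (i < j)%N)
      (-1) ^+ (i.+1 + j.+1) *: br (f (args (omit (omit x j) (inord i))))
                                  (br (h (x i)) (h (x j))).
Proof.
elim: n f x => [|n IH] f x.
  rewrite (big_pair_max (ltn 0)) !(big_ord_max (ltn 0)) /=.
  rewrite !big_ord0 !addr0 add0r subrr sub0r subr0 opprK sqrrN expr1n scale1r.
  by congr (br (br (h (x _)) _) _); apply/val_inj.
have -> : args x = x ord_max :: args (omit x ord_max) by [].
rewrite (big_ord_max (ltn 0)) (big_pair_max (ltn 0)).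
under [X in _ = X + _ + _]eq_bigr => i _ do
  rewrite -(lift_max0 n) args_omit2 lift_max.
under [X in _ = _ + (X + _)]eq_bigr => i _.
  under eq_bigr => j ij do
    rewrite (inord_lift_max (leq_trans ij (leq_ord j))) args_omit2 !lift_max.
  over.
set y := x ord_max; set x' := omit x ord_max; pose c u := br (h u) (h y).
rewrite -[LHS]/(cup br _ (f \o cons y) (args x') - brk br c f (args x')) IH.
have x'0 : x' ord0 = x ord0 by rewrite /x' /= lift_max0.
rewrite x'0 -!addrA; congr (_ + _).
rewrite [RHS]addrCA; congr (_ + _).
(* The sign is inserted twice so that [brk_args] applies. Its [x ord0] term closes the first sum;
   the others are the pairs with [j = ord_max]. *)
rewrite -[brk _ _ _ _](signrZK n.+2) brk_args x'0.
rewrite scalerDr opprD -!scaleNr -mulN1r -exprS.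
rewrite -[(-1) ^+ ord_max.+1]/((-1) ^+ n.+3).
congr (_ + _).
rewrite scaler_sumr; apply: eq_bigr => i _.
by rewrite scalerA -exprD addnC lift_max inord_val.
Qed.

(** * Transfer between list functions and functions of tuples *)

Definition represents n (f : seq L -> L) (g : ('I_n -> L) -> L) :=
  forall x, f (args x) = g x.

Lemma represents_leibniz_d p n f (g : ('I_n -> L) -> L) : represents f g ->
  represents ((-1) ^+ n.+1 *: list_d br alpha p f) (leibniz_d br alpha p g).
Proof.
move=> fg x; rewrite -[LHS]/((-1) ^+ n.+1 *: (brk br (iter p alpha) f (args x)
  - ctr br alpha f (args x))) scalerBr brk_args ctr_args /leibniz_d -fg.
congr (_ + _ + _); first by apply: eq_bigr => i _; rewrite fg.
by do 2![apply: eq_bigr => ? _]; rewrite fg.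
Qed.

Lemma represents_mixed_d m f (g : ('I_m.+1 -> L) -> L) : represents f g ->
  represents (list_mixed_d br alpha m f) (mixed_d br alpha g).
Proof.
move=> fg x; rewrite /list_mixed_d cup_args /mixed_d.
congr (_ + _); first by apply: eq_bigr => i _; rewrite fg.
by do 2![apply: eq_bigr => ? _]; rewrite fg.
Qed.

Lemma represents_alpha_d n f (g : ('I_n -> L) -> L) : represents f g ->
  represents (list_alpha_d alpha f) (alpha_d alpha g).
Proof.
move=> fg x; rewrite /alpha_d -!fg args_map.
by [].
Qed.

Lemma represents_fun n f (g g' : ('I_n -> L) -> L) :
  represents f g -> represents f g' -> g = g'.
Proof. by move=> fg fg'; apply/funext => x; rewrite -fg fg'. Qed.

(* Lists of the wrong length are sent to 0, which makes [on_args g] multiadditive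
   on all lists. *)
Definition on_args n (g : ('I_n -> L) -> L) s :=
  if size s == n then g (fun i => s`_(n - i.+1)) else 0.

Lemma represents_on_args n (g : ('I_n -> L) -> L) : represents (on_args g) g.
Proof.
move=> x; rewrite /on_args size_args eqxx; congr g.
by apply/funext => i; rewrite nth_args.
Qed.

Lemma on_args_multiadditive n (g : ('I_n -> L) -> L) :
  g \in multilinear -> multiadditive (on_args g).
Proof.
move=> /multilinearP gP s1 s2 u v; rewrite /on_args !size_cat /=.
case: eqP => [n_eq|]; last by rewrite addr0.
have k_lt : (size s2 < n)%N by rewrite -n_eq addnS ltnS leq_addl.
(* The list is reversed, so the slot before [s2] holds the argument of index [size s2]; [E]
   overwrites the placeholder [0]. *)
pose x (i : 'I_n) := (s1 ++ 0 :: s2)`_(n - i.+1).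
have E w : (fun i : 'I_n => (s1 ++ w :: s2)`_(n - i.+1)) =
           [eta x with Ordinal k_lt |-> w].
  apply/funext => i; rewrite /x /= !nth_cat -val_eqE /=.
  have [->|ne] := eqVneq.
    by rewrite -n_eq addnS subSS addnK ltnn subnn.
  case: ltnP => // le; case E: (_ - _)%N => [|k //].
  case/eqP: ne; apply/succn_inj/(@addnI (size s1)).
  rewrite n_eq -[RHS](subnK (ltn_ord i)); congr (_ + _)%N.
  by apply/eqP; rewrite eqn_leq le -subn_eq0 E.
by have := gP (Ordinal k_lt) x 1 u v; rewrite !scale1r !E.
Qed.

(** * Relations between the differentials *)

Hypothesis K2 : 2 \notin [pchar K].
Hypothesis leib : hom_leibniz br alpha.
Hypothesis mult : hom_multiplicative br alpha.

(** Kept as a representation because the same list function is compared with both composites of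
    [mixed_d] and [alpha_d]. *)
Lemma leibniz_d_leibniz_d p n (g : ('I_n -> L) -> L) : g \in multilinear ->
  represents (list_mixed_d br alpha p (list_alpha_d alpha (on_args g)))
             (leibniz_d br alpha p.+1 (leibniz_d br alpha p g)).
Proof.
move=> gP; have gR := represents_on_args g => x.
rewrite -(represents_leibniz_d _ (represents_leibniz_d _ gR)).
rewrite list_dZ list_d_list_d //; last exact: on_args_multiadditive.
(* Consecutive arities give the sign [-1], which cancels that of [list_d_list_d]. *)
by rewrite exprS mulN1r scaleNr !scalerN signrZK opprK.
Qed.

Lemma leibniz_d_mixed_d m (g : ('I_m.+1 -> L) -> L) :
  leibniz_d br alpha m.+2 (mixed_d br alpha g) =
  mixed_d br alpha (leibniz_d br alpha m.+1 g).
Proof.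
have gR := represents_on_args g.
apply: represents_fun (represents_leibniz_d _ (represents_mixed_d gR)) _.
rewrite list_d_mixed_d // -list_mixed_dZ.
(* The arities [m.+3] and [m.+1] have the same parity, so the signs agree. *)
rewrite [(-1) ^+ m.+4]exprS [(-1) ^+ m.+3]exprS !mulN1r opprK.
exact: represents_mixed_d (represents_leibniz_d m.+1 gR).
Qed.

Lemma alpha_d_leibniz_d p n (g : ('I_n -> L) -> L) :
  alpha_d alpha (leibniz_d br alpha p g) =
  leibniz_d br alpha p.+1 (alpha_d alpha g).
Proof.
have gR := represents_on_args g.
apply: represents_fun (represents_alpha_d (represents_leibniz_d _ gR)) _.
rewrite list_alpha_dZ list_alpha_list_d //.
exact: represents_leibniz_d (represents_alpha_d gR).
Qed.

Lemma alpha_d_mixed_d m (g : ('I_m.+1 -> L) -> L) : g \in multilinear ->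
  alpha_d alpha (mixed_d br alpha g) =
  leibniz_d br alpha m.+2 (leibniz_d br alpha m.+1 g).
Proof.
move=> gP; apply: represents_fun (leibniz_d_leibniz_d _ gP).
rewrite -list_alpha_mixed_d //.
exact: represents_alpha_d (represents_mixed_d (represents_on_args g)).
Qed.

Lemma mixed_d_alpha_d m (g : ('I_m.+1 -> L) -> L) : g \in multilinear ->
  mixed_d br alpha (alpha_d alpha g) =
  leibniz_d br alpha m.+1 (leibniz_d br alpha m g).
Proof.
move=> gP; apply: represents_fun (leibniz_d_leibniz_d _ gP).
exact: represents_mixed_d (represents_alpha_d (represents_on_args g)).
Qed.

End ReversedArguments.

Theorem theorem4p1 (K : fieldType) (L : lmodType K)
    (br : {bilinear L -> L -> L}) (alpha : {linear L -> L}) :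
  [pchar K] =i pred0 ->
  hom_leibniz br alpha ->
  hom_multiplicative br alpha ->
  forall (n : int) (c : cochain L n),
    coboundary br alpha (coboundary br alpha c) = 0.
Proof.
move=> K0 leib mult n c.
have K2 : 2 \notin [pchar K] by rewrite K0.
(* These four identities cancel the [phi] and [psi] parts of each component of the square
   separately. *)
have dgg_dag m (f : multilin L m.+1) : d_gg br alpha (d_gg br alpha f) =
    d_ag br alpha (d_ga alpha f).
  exact/val_inj/esym/(mixed_d_alpha_d K2 leib mult)/multilin_funP.
have dga_dgg m (f : multilin L m.+1) : d_ga alpha (d_gg br alpha f) =
    d_aa br alpha (d_ga alpha f).
  exact/val_inj/alpha_d_leibniz_d.
have dgg_dag' m (f : multilin L m.+1) : d_gg br alpha (d_ag br alpha f) =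
    d_ag br alpha (d_aa br alpha f).
  exact/val_inj/leibniz_d_mixed_d.
have dga_dag m (f : multilin L m.+1) : d_ga alpha (d_ag br alpha f) =
    d_aa br alpha (d_aa br alpha f).
  exact/val_inj/(alpha_d_mixed_d K2 leib mult)/multilin_funP.
(* In degrees at most zero the inner coboundary is zero by definition. *)
case: n c => [[|[|m]]|m] c; try exact: linear0.
  by congr (_, _); rewrite /= ?dgg_dag ?dga_dgg subrr.
case: c => phi psi; congr (_, _) => /=.
  rewrite !(zmod_morphism_linear (@d_gg_linear _ _ _ _ _)).
  rewrite !(zmod_morphism_linear (@d_ag_linear _ _ _ _ _)).
  by rewrite dgg_dag dgg_dag' subrr.
rewrite !(zmod_morphism_linear (@d_ga_linear _ _ _ _)).
rewrite !(zmod_morphism_linear (@d_aa_linear _ _ _ _ _)).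
by rewrite dga_dgg dga_dag subrr.
Qed.
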